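(* Let $\mathbb{P}$ be a Datalog program and $\mathcal{I}$ a database instance. Suppose $i$ steps of one-rule-per-step semi-naive evaluation have been performed, that the rule $$r=\ p(\vec t)\leftarrow e_1(\vec{t_1}),\ldots,e_n(\vec{t_n}),q_1(\vec{s_1}),\ldots,q_m(\vec{s_m})$$ of $\mathbb{P}$ (with $e_1,\ldots,e_n$ EDB predicates and $p,q_1,\ldots,q_m$ IDB predicates) is to be applied in step $i+1$, and that $j<i+1$ was the last step in which $r$ was applied. Fix $\ell\in\{1,\ldots,m\}$ and consider the join $$J=R_{\mathsf{EDB}}\bowtie\Delta_{q_1}^{[l_1,u_1]}(\vec{s_1})\bowtie\cdots\bowtie\Delta_{q_m}^{[l_m,u_m]}(\vec{s_m}),$$ where $[l_b,u_b]=[0,i]$ for $b<\ell$, $[l_\ell,u_\ell]=[j,i]$, and $[l_b,u_b]=[0,j-1]$ for $b>\ell$. Let $k\in\{1,\ldots,m\}$, let $$R_k=R_{\mathsf{EDB}}\bowtie\Delta_{q_1}^{[l_1,u_1]}(\vec{s_1})\bowtie\cdots\bowtie\Delta_{q_{k-1}}^{[l_{k-1},u_{k-1}]}(\vec{s_{k-1}}),$$ and let $o\in[l_k,u_k]$ be a step with $\Delta_{q_k}^o\neq\emptyset$, produced by applying $\mathsf{rule}[o]$, such that the head of $\mathsf{rule}[o]$ unifies with $q_k(\vec{s_k})$. Let $r_o$ be the rule obtained by resolving $r$ with $\mathsf{rule}[o]$ on $q_k(\vec{s_k})$. If, for all $\sigma\in R_k$, the rule $r_o\sigma$ is trivially redundant,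 then the result of the join $J$ remains the same when replacing the relation $\Delta_{q_k}^{[l_k,u_k]}$ (in the $k$-th IDB position) by $\Delta_{q_k}^{[l_k,u_k]}\setminus\Delta_{q_k}^o$.
   Context: **Datalog.** Terms are constants or variables; an atom is $p(\vec t)$ with $|\vec t|$ equal to the arity of $p$; a fact is a variable-free atom; a database instance is a finite set of facts. A rule is an expression $H\leftarrow B_1,\ldots,B_n$ with head atom $H$ and body atoms $B_1,\ldots,B_n$, assumed safe: every variable of $H$ occurs in some $B_i$. A program is a finite set of rules. Predicates occurring in the head of a rule are IDB predicates; all others are EDB predicates. IDB predicates must not appear in database instances. A substitution is a partial map from variables to constants and variables. **One-rule-per-step semi-naive evaluation.** In each step one rule of $\mathbb{P}$ is applied; $\mathsf{rule}[i]$ denotes the rule applied in step $i$. $\Delta_p^i$ denotes the set of new facts with predicate $p$ derived in step $i$; thus $\Delta_p^i=\emptyset$ if $p$ is not the head predicate of $\mathsf{rule}[i]$. Steps are numbered from $1$, and $\Delta_p^0=\emptyset$. Write $\Delta_p^{[a,b]}=\bigcup_{k=a}^b\Delta_p^k$. Suppose the rule applied in step $i+1$ is $r$ as displayed in the claim. - If $r$ has not been applied before, $\mathrm{tmp}_p$ is the set of all facts $p(\vec t)\sigma$ such that $e_a(\vec{t_a})\sigma\in\mathcal{I}$ for all $a$ and $q_b(\vec{s_b})\sigma\in\Delta^{[0,i]}_{q_b}$ for all $b$. - If $r$ was last applied in step $j<i+1$, $\mathrm{tmp}_p$ is the union over all $\ell\in\{1,\ldots,m\}$ of the sets of all facts $p(\vec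 t)\sigma$ such that $e_a(\vec{t_a})\sigma\in\mathcal{I}$ for all $a$, $q_b(\vec{s_b})\sigma\in\Delta_{q_b}^{[0,i]}$ for $b<\ell$, $q_\ell(\vec{s_\ell})\sigma\in\Delta_{q_\ell}^{[j,i]}$, and $q_b(\vec{s_b})\sigma\in\Delta_{q_b}^{[0,j-1]}$ for $b>\ell$. In both cases $\Delta_p^{i+1}=\mathrm{tmp}_p\setminus\Delta_p^{[0,i]}$. For each $\ell$, the join $J$ computes all matches of the rule body for that $\ell$. **Joins.** $R_{\mathsf{EDB}}$ is the relation obtained by joining the EDB atoms $e_1(\vec{t_1}),\ldots,e_n(\vec{t_n})$ over $\mathcal{I}$. The relation $R_k$ yields all possible instantiations of the variables occurring in $\vec{t_1},\ldots,\vec{t_n},\vec{s_1},\ldots,\vec{s_{k-1}}$ for which $e_a(\vec{t_a})$ is mapped into $\mathcal{I}$ for all $a$ and $q_b(\vec{s_b})$ is mapped into $\Delta_{q_b}^{[l_b,u_b]}$ for all $b<k$; it is viewed as a set of partial substitutions $\sigma$ that may lead to a match of $r$. The full join $J$ is defined likewise with all $m$ IDB atoms. **Resolution and redundancy.** If the head of $\mathsf{rule}[o]$ unifies with $q_k(\vec{s_k})$, resolving $r$ with $\mathsf{rule}[o]$ (i.e. applying backward chaining) gives the rule $$r_o=\ p(\vec t)\leftarrow e_1(\vec{t_1}),\ldots,e_n(\vec{t_n}),q_1(\vec{s_1}),\ldots,q_{k-1}(\vec{s_{k-1}}),\mathsf{Body}_{\mathsf{rule}[o]},q_{k+1}(\vec{s_{k+1}}),\ldots,q_m(\vec{s_m}),$$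 where $\mathsf{Body}_{\mathsf{rule}[o]}$ is a variant of the body of $\mathsf{rule}[o]$ to which a most general unifier (of the head of $\mathsf{rule}[o]$ and $q_k(\vec{s_k})$) has been applied. A rule is trivially redundant if its head atom occurs in its body.
   Formalization: ''The result of the join J remains the same'' is proved for the matches whose head instance is not already among the facts derived in steps 0 to i (those contributing new facts); literal equality of all matches of J is false, since matches yielding only duplicate facts can be lost. *)

(* Defs.v *)
From mathcomp Require Import all_boot finmap.
From mathcomp Require Import classical_sets.
Set Implicit Arguments.
Unset Strict Implicit.
Unset Printing Implicit Defensive.

Local Open Scope fset_scope.
Local Open Scope classical_set_scope.

Section Syntax.
(* Constants, predicate symbols and their arities; the variables are the natural
   numbers. *)
Variables (C Pr : choiceType) (ar : Pr -> nat).

Definition term : choiceType := (C + nat)%type.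
Definition Cst (c : C) : term := inl c.
Definition Var (x : nat) : term := inr x.

Definition atom : choiceType := {p : Pr & (ar p).-tuple term}.
Definition apred (a : atom) : Pr := tag a.
Definition aargs (a : atom) : seq term := tval (tagged a).

Definition term_vars (t : term) : seq nat := if t is inr x then [:: x] else [::].
Definition atom_vars (a : atom) : seq nat := flatten (map term_vars (aargs a)).
Definition atoms_vars (s : seq atom) : seq nat := flatten (map atom_vars s).

Definition is_fact (a : atom) : bool := nilp (atom_vars a).

(* (head, body).  Safety is imposed on programs only, since resolvents and
   instances of rules are again pairs of this type. *)
Definition rule : choiceType := (atom * seq atom)%type.
Definition rhead (r : rule) : atom := r.1.
Definition rbody (r : rule) : seq atom := r.2.
Definition rule_vars (r : rule) : seq nat := atoms_vars (rhead r :: rbody r).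
Definition safe (r : rule) : bool :=
  all (mem (atoms_vars (rbody r))) (atom_vars (rhead r)).

Definition idb_preds (P : {fset rule}) : {fset Pr} :=
  [fset apred (rhead r) | r in P].

Definition is_program (P : {fset rule}) : Prop := forall r, r \in P -> safe r.

Definition is_database (P : {fset rule}) (I : {fset atom}) : Prop :=
  forall a, a \in I -> is_fact a /\ apred a \notin idb_preds P.

(* [e_1(t_1), ..., e_n(t_n)] and [q_1(s_1), ..., q_m(s_m)]: the EDB and the IDB
   atoms of the body, in order. *)
Definition edb_body (P : {fset rule}) (r : rule) : seq atom :=
  [seq a <- rbody r | apred a \notin idb_preds P].
Definition idb_body (P : {fset rule}) (r : rule) : seq atom :=
  [seq a <- rbody r | apred a \in idb_preds P].

(* Positions of IDB body atoms are numbered from 0. *)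
Definition idb_pos (P : {fset rule}) (r : rule) : Type := 'I_(size (idb_body P r)).
Definition idb_atom (P : {fset rule}) (r : rule) (b : idb_pos P r) : atom :=
  tnth (in_tuple (idb_body P r)) b.

(* A partial map; variables outside its domain are left unchanged. *)
Definition subst : Type := nat -> option term.

Definition term_subst (s : subst) (t : term) : term :=
  if t is inr x then odflt t (s x) else t.
Definition atom_subst (s : subst) (a : atom) : atom :=
  Tagged (fun p => (ar p).-tuple term) (map_tuple (term_subst s) (tagged a)).
Definition rule_subst (s : subst) (r : rule) : rule :=
  (atom_subst s (rhead r), map (atom_subst s) (rbody r)).

Definition unifier (s : subst) (a b : atom) : Prop :=
  atom_subst s a = atom_subst s b.

(* Most general unifiers are idempotent, as usual.  This matters below: the
   resolvent is instantiated by substitutions that refer to the variables of the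
   resolved rule by name, so a unifier must not permute those variables. *)
Definition mgu (s : subst) (a b : atom) : Prop :=
  [/\ unifier s a b,
      forall s', unifier s' a b -> exists d : subst,
        forall t, term_subst s' t = term_subst d (term_subst s t)
    & forall t, term_subst s (term_subst s t) = term_subst s t].

Definition renaming (f : nat -> nat) : subst := fun x => Some (Var (f x)).

(* [r'] is a variant of [r0] that shares no variable with [r]. *)
Definition variant_apart (r r0 r' : rule) : Prop :=
  (exists2 f, bijective f & r' = rule_subst (renaming f) r0) /\
  (forall x, x \in rule_vars r' -> x \notin rule_vars r).

(* [ro] results from resolving [r] with [r0] on the IDB atom [q_k(s_k)]:
   p(t) <- e_1(t_1), ..., e_n(t_n), q_1(s_1), ..., q_{k-1}(s_{k-1}),
           Body_{r0}, q_{k+1}(s_{k+1}), ..., q_m(s_m),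
   where the most general unifier is applied to the body of the variant of [r0]. *)
Definition resolvent (P : {fset rule}) (r : rule) (k : idb_pos P r)
    (r0 ro : rule) : Prop :=
  exists r' mu, [/\ variant_apart r r0 r', mgu mu (rhead r') (idb_atom k) &
    ro = (rhead r, edb_body P r ++ take k (idb_body P r)
                  ++ map (atom_subst mu) (rbody r')
                  ++ drop k.+1 (idb_body P r))].

Definition trivially_redundant (r : rule) : bool := rhead r \in rbody r.

End Syntax.

Section Evaluation.
Variables (C Pr : choiceType) (ar : Pr -> nat).
Local Notation atom := (atom C ar).
Local Notation rule := (rule C ar).
Local Notation subst := (subst C).
Variables (P : {fset rule}) (I : {fset atom}).

(* [Delta p s] is Delta_p^s; [rl s] is the rule applied in step s. *)
Implicit Types (Delta : Pr -> nat -> set atom) (rl : nat -> rule).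

(* Delta_p^[a,b] *)
Definition Delta_range Delta (p : Pr) (a b : nat) : set atom :=
  \bigcup_(s in [set s | (a <= s <= b)%N]) Delta p s.

Definition body_match (r : rule) (D : idb_pos P r -> set atom) (s : subst) : Prop :=
  (forall a, a \in edb_body P r -> atom_subst s a \in I) /\
  (forall b : idb_pos P r, D b (atom_subst s (idb_atom b))).

Definition consequences (r : rule) (D : idb_pos P r -> set atom) : set atom :=
  [set f | is_fact f /\ exists2 s, body_match D s & f = atom_subst s (rhead r)].

(* The intervals [l_b, u_b] of the semi-naive joins:
   [0,i] for b < l, [j,i] for b = l, [0,j-1] for b > l. *)
Definition lo (j l b : nat) : nat := if b == l then j else 0.
Definition up (i j l b : nat) : nat := if (b <= l)%N then i else j.-1.

Definition sn_rel Delta (r : rule) (i j : nat) (l b : idb_pos P r) : set atom :=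
  Delta_range Delta (apred (idb_atom b)) (lo j l b) (up i j l b).

(* Steps are numbered from 1. *)
Definition not_applied rl (r : rule) (i : nat) : Prop :=
  forall s, (1 <= s <= i)%N -> rl s <> r.
Definition last_applied rl (r : rule) (j i : nat) : Prop :=
  [/\ (1 <= j <= i)%N, rl j = r & forall s, (j < s <= i)%N -> rl s <> r].

(* [is_tmp rl Delta r i T]: [T] is the set tmp_p computed by applying [r] in
   step i+1. *)
Definition is_tmp rl Delta (r : rule) (i : nat) (T : set atom) : Prop :=
  (not_applied rl r i ->
     T = consequences (fun b : idb_pos P r =>
           Delta_range Delta (apred (idb_atom b)) 0 i)) /\
  (forall j, last_applied rl r j i ->
     T = \bigcup_(l in [set: idb_pos P r]) consequences (sn_rel Delta i j l)).

(* [rl] and [Delta] record [n] steps of one-rule-per-step semi-naive evaluation;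
   their values beyond step [n] are irrelevant. *)
Definition seminaive rl Delta (n : nat) : Prop :=
  (forall p, Delta p 0 = set0) /\
  (forall i, (i < n)%N ->
    [/\ rl i.+1 \in P,
        exists2 T, is_tmp rl Delta (rl i.+1) i T &
          Delta (apred (rhead (rl i.+1))) i.+1 =
            T `\` Delta_range Delta (apred (rhead (rl i.+1))) 0 i
      & forall p, p <> apred (rhead (rl i.+1)) -> Delta p i.+1 = set0]).

Definition instantiation (xs : seq nat) (s : subst) : Prop :=
  forall x, if x \in xs then exists c, s x = Some (Cst c) else s x = None.

(* The join of R_EDB with [D b (s_b)] for the first [k] IDB positions [b]: all
   instantiations of the variables of the joined atoms that match these atoms.
   With [k] the number of IDB atoms this is the full join. *)
Definition join (r : rule) (D : idb_pos P r -> set atom) (k : nat) : set subst :=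
  [set s | [/\ instantiation
                 (atoms_vars (edb_body P r ++ take k (idb_body P r))) s,
               forall a, a \in edb_body P r -> atom_subst s a \in I
             & forall b : idb_pos P r, (b < k)%N ->
                 D b (atom_subst s (idb_atom b))]].

Definition full_join (r : rule) (D : idb_pos P r -> set atom) : set subst :=
  join D (size (idb_body P r)).

(* The matches in a join [J] that contribute to Delta_p^{i+1}, that is, those whose
   consequence p(t)s is not a duplicate of a fact derived in the first [i] steps.
   Equality of the joins themselves as sets of matches would be too strong:
   excluding derivations of duplicates does discard matches. *)
Definition join_result Delta (r : rule) (i : nat) (J : set subst) : set subst :=
  [set s | J s /\ ~ Delta_range Delta (apred (rhead r)) 0 i (atom_subst s (rhead r))].

Definition remove_at (r : rule) (D : idb_pos P r -> set atom)
    (k : idb_pos P r) (X : set atom) : idb_pos P r -> set atom :=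
  fun b => if b == k then D b `\` X else D b.

End Evaluation.

(* Main.v *)
(* If a match s of the full join used a fact of Delta^o in position k, this fact
   would come from a match t of the body of rule[o] over facts derived before step o.
   Together, s and t give a substitution h that unifies the head of rule[o] with
   q_k(s_k); as the most general unifier mu is idempotent, h o mu = h.  Applying h to
   the trivially redundant rule shows that the head instance p(t)s occurs among body
   facts of r or of rule[o], and since p is an IDB predicate, p(t)s was already derived
   in the first i steps. *)
Require Import Defs.
From mathcomp Require Import all_boot finmap.
From mathcomp Require Import boolp classical_sets.
Set Implicit Arguments.
Unset Strict Implicit.
Unset Printing Implicit Defensive.

Local Open Scope fset_scope.
Local Open Scope classical_set_scope.

(** * Restricting, gluing and absorbing substitutions *)

Section Substitutions.
Variables (C Pr : choiceType) (ar : Pr -> nat).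
Implicit Types (a : atom C ar) (s : subst C) (r : rule C ar) (xs : seq nat).

Lemma apred_subst s a : apred (atom_subst s a) = apred a.
Proof. by []. Qed.

Lemma mem_atom_vars a x : Var C x \in aargs a -> x \in atom_vars a.
Proof.
by move=> xa; apply/flattenP; exists [:: x]; rewrite ?inE//; apply/mapP; exists (Var C x).
Qed.

Lemma mem_atoms_vars (l : seq (atom C ar)) a x :
  a \in l -> x \in atom_vars a -> x \in atoms_vars l.
Proof. by move=> al xa; apply/flatten_mapP; exists a. Qed.

(** Here [f] and [g] are arbitrary maps on terms, so that a composition of two [term_subst], which
    is not itself given as a [subst], is covered too. *)
Lemma eq_atom_map (f g : term C -> term C) (p : Pr) (u : (ar p).-tuple (term C)) :
  {in u, f =1 g} ->
  Tagged (fun p => (ar p).-tuple (term C)) (map_tuple f u) =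
  Tagged (fun p => (ar p).-tuple (term C)) (map_tuple g u).
Proof. by move=> fg; congr Tagged; apply: val_inj; apply/eq_in_map. Qed.

Lemma eq_in_atom_subst s1 s2 a :
  {in atom_vars a, forall x, term_subst s1 (Var C x) = term_subst s2 (Var C x)} ->
  atom_subst s1 a = atom_subst s2 a.
Proof.
move=> e; apply: eq_atom_map => -[c|x] //= xa.
by apply: e; apply: mem_atom_vars.
Qed.

Lemma atom_subst_comp s1 s2 s3 a :
  {in atom_vars a, forall x,
     term_subst s1 (term_subst s2 (Var C x)) = term_subst s3 (Var C x)} ->
  atom_subst s1 (atom_subst s2 a) = atom_subst s3 a.
Proof.
move=> e; rewrite /atom_subst /=.
have -> : map_tuple (term_subst s1) (map_tuple (term_subst s2) (tagged a)) =
          map_tuple (term_subst s1 \o term_subst s2) (tagged a).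
  by apply: val_inj; rewrite /= -map_comp.
apply: eq_atom_map => -[c|x] //= xa.
by apply: e; apply: mem_atom_vars.
Qed.

Definition subst_restrict xs s : subst C := fun x => if x \in xs then s x else None.

(** On [xs] the values of [s] are constants, which [s'] fixes, and [s'] agrees with [s] there;
    elsewhere the restriction changes nothing. *)
Lemma subst_restrictK s s' xs xs' t :
  instantiation xs' s -> {subset xs <= xs'} ->
  {in xs', forall x, s' x = s x} ->
  term_subst s' (term_subst (subst_restrict xs s) t) = term_subst s' t.
Proof.
move=> inst sub e; case: t => [c|x] //=; rewrite /subst_restrict.
case: ifP => //= /sub xs'x; rewrite (e _ xs'x).
by have := inst x; rewrite xs'x => -[c ->].
Qed.

(** By universality [s] acts as [d] after [mu]; idempotence of [mu] then lets a further [mu] in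
    front disappear. *)
Lemma mgu_absorbed s mu a b :
  mgu mu a b -> unifier s a b ->
  forall t, term_subst s (term_subst mu t) = term_subst s t.
Proof.
by move=> [_ univ idem] /univ[d e] t; rewrite [RHS]e e idem.
Qed.

(* Unbound variables of [s2] must be handled by [term_subst]: a renamed variable
   is sent to the unrenamed one, not to itself. *)
Definition subst_glue xs s1 (g : nat -> nat) s2 : subst C :=
  fun x => if x \in xs then s1 x else Some (term_subst s2 (Var C (g x))).

Lemma subst_glue_l xs s1 g s2 a :
  {subset atom_vars a <= xs} -> atom_subst (subst_glue xs s1 g s2) a = atom_subst s1 a.
Proof.
by move=> sub; apply: eq_in_atom_subst => x /sub xsx; rewrite /subst_glue /= xsx.
Qed.

Lemma atom_vars_renaming f a x :
  x \in atom_vars a -> f x \in atom_vars (atom_subst (renaming C f) a).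
Proof.
move=> /flatten_mapP[[c|y] ya]; rewrite //= inE => /eqP ->.
by apply: mem_atom_vars; apply/mapP; exists (Var C y).
Qed.

Lemma subst_glue_r xs s1 f g s2 a :
  cancel f g ->
  {in atom_vars (atom_subst (renaming C f) a), forall x, x \notin xs} ->
  atom_subst (subst_glue xs s1 g s2) (atom_subst (renaming C f) a) = atom_subst s2 a.
Proof.
move=> fK dis; apply: atom_subst_comp => x xa /=; rewrite /subst_glue.
by rewrite (negbTE (dis _ (atom_vars_renaming f xa))) /= fK.
Qed.

(** Applying [s'] to the equality between head and body atom of the instance erases [s], since [s']
    absorbs it. *)
Lemma trivially_redundant_subst s s' r :
  (forall t, term_subst s' (term_subst s t) = term_subst s' t) ->
  trivially_redundant (rule_subst s r) ->
  exists2 a, a \in rbody r & atom_subst s' (rhead r) = atom_subst s' a.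
Proof.
move=> e /mapP[a ain ea]; exists a => //.
have comp (b : atom C ar) : atom_subst s' (atom_subst s b) = atom_subst s' b.
  by apply: atom_subst_comp => x _; apply: e.
by rewrite -comp -[RHS]comp; congr atom_subst; apply: ea.
Qed.

End Substitutions.

(** * Semi-naive runs and their joins *)

Section Runs.
Variables (C Pr : choiceType) (ar : Pr -> nat).
Variables (P : {fset rule C ar}) (I : {fset atom C ar}).
Implicit Types (Delta : Pr -> nat -> set (atom C ar)) (rl : nat -> rule C ar).
Implicit Types (r : rule C ar).

Lemma rhead_idb r : r \in P -> apred (rhead r) \in idb_preds P.
Proof. by move=> rP; apply/imfsetP; exists r. Qed.

Lemma mem_idb_atom r (b : idb_pos P r) : idb_atom b \in idb_body P r.
Proof. exact: mem_tnth. Qed.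

Lemma idb_atomP r a :
  a \in idb_body P r -> exists b : idb_pos P r, a = idb_atom b.
Proof. by move=> /(tnthP (in_tuple _))[b ->]; exists b. Qed.

Lemma mem_rbody r a :
  (a \in rbody r) = (a \in edb_body P r) || (a \in idb_body P r).
Proof. by rewrite !mem_filter -andb_orl orNb. Qed.

Lemma Delta_range_sub Delta p a b a' b' :
  (a' <= a)%N -> (b <= b')%N ->
  Delta_range Delta p a b `<=` Delta_range Delta p a' b'.
Proof.
move=> aa bb f [s /= /andP[as_ sb] fs]; exists s => //=.
by rewrite (leq_trans aa as_) (leq_trans sb bb).
Qed.

Lemma up_le i j l b : (j <= i.+1)%N -> (up i j l b <= i)%N.
Proof. by rewrite /up; case: ifP => // _; case: j. Qed.

Lemma sn_rel_sub Delta r i j (l b : idb_pos P r) : (j <= i.+1)%N ->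
  sn_rel Delta i j l b `<=` Delta_range Delta (apred (idb_atom b)) 0 i.
Proof. by move=> ji; apply: Delta_range_sub => //; apply: up_le. Qed.

(** The two clauses of [is_tmp] are conditional; together they determine [T] because these cases are
    exhaustive. *)
Lemma applied_dec rl r i :
  not_applied rl r i \/ exists j, last_applied rl r j i.
Proof.
elim: i => [|i [na|[j [/andP[j1 ji] ej lj]]]]; first by left; case.
- have [e|ne] := eqVneq (rl i.+1) r.
    right; exists i.+1; split=> //; first by rewrite leqnn.
    by move=> s /andP[/leq_trans h /h]; rewrite ltnn.
  left=> s /andP[s1]; rewrite leq_eqVlt ltnS => /orP[/eqP ->|si]; first exact/eqP.
  by apply: na; rewrite s1.
- have [e|ne] := eqVneq (rl i.+1) r.
    right; exists i.+1; split=> //; first by rewrite leqnn.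
    by move=> s /andP[/leq_trans h /h]; rewrite ltnn.
  right; exists j; split=> //; first by rewrite j1 (leq_trans ji).
  move=> s /andP[js]; rewrite leq_eqVlt ltnS => /orP[/eqP ->|si]; first exact/eqP.
  by apply: lj; rewrite js.
Qed.

(** All intervals of the semi-naive joins lie in [0,i], so both kinds of step give the same weak
    conclusion. *)
Lemma seminaive_derived rl Delta n i p f :
  seminaive P I rl Delta n -> (i < n)%N -> Delta p i.+1 f ->
  exists2 t, f = atom_subst t (rhead (rl i.+1)) &
    forall b, b \in rbody (rl i.+1) ->
      atom_subst t b \in I \/ Delta_range Delta (apred b) 0 i (atom_subst t b).
Proof.
move=> [_ step] /step[rP [T [Tfirst Tlast] eT] other] fD.
(* A step derives facts for its head predicate only. *)
have ep : p = apred (rhead (rl i.+1)).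
  by apply: contrapT => /other e; rewrite e in fD.
move: fD; rewrite ep eT => -[Tf _].
have [t [edb idb] ->] : exists2 t, body_match I (fun b : idb_pos P (rl i.+1) =>
    Delta_range Delta (apred (idb_atom b)) 0 i) t & f = atom_subst t (rhead (rl i.+1)).
  have [/Tfirst e|[j lj]] := applied_dec rl (rl i.+1) i.
    by move: Tf; rewrite e => -[].
  move: Tf; rewrite (Tlast _ lj) => -[l _ [_ [t [edb idb] ->]]].
  exists t => //; split=> // b; apply: sn_rel_sub (idb b).
  by case: lj => /andP[_ ji] _ _; apply: leqW.
exists t => // b; rewrite mem_rbody => /orP[/edb|/idb_atomP[c ->]]; first by left.
by right; apply: idb.
Qed.

(** Turns a full match into an element of R_k. The restriction is needed because [instantiation]
    fixes the domain exactly. *)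
Lemma join_restrict r (D : idb_pos P r -> set (atom C ar)) k s :
  full_join I D s ->
  join I D k (subst_restrict (atoms_vars (edb_body P r ++ take k (idb_body P r))) s).
Proof.
move=> [inst edb idb]; set xs := atoms_vars _ in inst *; set ys := atoms_vars _.
have sub : {subset ys <= xs}.
  move=> x /flatten_mapP[a ain xa]; apply: (mem_atoms_vars _ xa).
  by move: ain; rewrite take_size !mem_cat => /orP[->|/mem_take ->]; rewrite ?orbT.
have same a : a \in edb_body P r ++ take k (idb_body P r) ->
    atom_subst (subst_restrict ys s) a = atom_subst s a.
  move=> ain; apply: eq_in_atom_subst => x xa.
  by rewrite /subst_restrict /= (mem_atoms_vars ain xa).
split.
- move=> x; rewrite /subst_restrict; case xys: (x \in ys) => //.
  by have := inst x; rewrite (sub _ xys).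
- by move=> a ain; rewrite same ?mem_cat ?ain//; apply: edb.
- move=> b bk; rewrite same; first exact: idb.
  rewrite mem_cat; apply/orP; right; rewrite /idb_atom (tnth_nth (idb_atom b)) /=.
  by rewrite -(nth_take _ bk) mem_nth// size_take; case: ifP.
Qed.

End Runs.

Theorem theorem3 (C Pr : choiceType) (ar : Pr -> nat)
    (P : {fset rule C ar}) (I : {fset atom C ar})
    (hP : is_program P) (hI : is_database P I)
    (i : nat) (rl : nat -> rule C ar) (Delta : Pr -> nat -> set (atom C ar))
    (hrun : seminaive P I rl Delta i)
    (r : rule C ar) (hr : r \in P) (hnext : rl i.+1 = r)
    (j : nat) (hj : last_applied rl r j i)
    (l k : idb_pos P r)
    (o : nat) (ho : (lo j l k <= o <= up i j l k)%N)
    (hne : Delta (apred (idb_atom k)) o <> set0)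
    (ro : rule C ar) (hro : resolvent k (rl o) ro)
    (hred : forall s : subst C, join I (sn_rel Delta i j l) k s ->
       trivially_redundant (rule_subst s ro)) :
  join_result Delta r i
    (full_join I (remove_at (sn_rel Delta i j l) k (Delta (apred (idb_atom k)) o)))
  = join_result Delta r i (full_join I (sn_rel Delta i j l)).
Proof.
have ji : (j <= i.+1)%N by case: hj => /andP[_ ?] _ _; apply: leqW.
apply/seteqP; split=> s [[inst edb idb] new]; split=> //; split=> // b bm.
  (* Shrinking a relation can only lose matches; the other inclusion is the substantial one. *)
  by have := idb b bm; rewrite /remove_at; case: ifP => // _ [].
have sJ : full_join I (sn_rel Delta i j l) s by [].
rewrite /remove_at; case: ifP => [/eqP ->|_]; last exact: idb.
split=> [|fo]; first by apply: idb.
have oi : (o <= i)%N by case/andP: ho => _ /leq_trans -> //; apply: up_le.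
(* Step 0 derives nothing, so [o] becomes a successor and the body of its rule was matched over the
   steps up to the new [o]. *)
case: o ho hne hro fo oi => [|o] _ _ hro fo oi.
  by case: hrun => D0 _; rewrite D0 in fo.
have [t ft tbody] := seminaive_derived hrun oi fo.
case: hro hred => r' [mu [[[f [g fK gK] er'] apart] hmu ->]] hred.
(* [h] acts as [s] on the variables of [r], and on those of the variant [r'] as [t] after undoing
   the renaming. *)
pose h := subst_glue (rule_vars r) s g t.
have hs a : a \in rhead r :: rbody r -> atom_subst h a = atom_subst s a.
  by move=> ain; apply: subst_glue_l => x; apply: mem_atoms_vars.
have hidb (c : idb_pos P r) : atom_subst h (idb_atom c) = atom_subst s (idb_atom c).
  by apply: hs; rewrite inE (mem_rbody P) mem_idb_atom !orbT.
have ht a : a \in rhead (rl o.+1) :: rbody (rl o.+1) ->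
    atom_subst h (atom_subst (renaming C f) a) = atom_subst t a.
  move=> ain; apply: subst_glue_r => // x xa; apply: apart.
  apply: (mem_atoms_vars _ xa); rewrite er'.
  exact: (map_f (atom_subst (renaming C f)) ain).
(* Both instances are the fact of [fo], which is the head of the rule of step [o.+1] under [t]. *)
have hu : unifier h (rhead r') (idb_atom k).
  by rewrite /unifier hidb er' ht ?mem_head.
have hmuK := mgu_absorbed hmu hu.
have hsigma t0 : term_subst h (term_subst (subst_restrict
    (atoms_vars (edb_body P r ++ take k (idb_body P r))) s) t0) = term_subst h t0.
  apply: subst_restrictK inst _ _ => x /flatten_mapP[a ain xa].
    apply: (mem_atoms_vars _ xa); move: ain.
    by rewrite take_size !mem_cat => /orP[->|/mem_take ->]; rewrite ?orbT.
  rewrite /h /subst_glue (@mem_atoms_vars _ _ _ _ a)//.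
  by move: ain; rewrite take_size inE (mem_rbody P) mem_cat => ->; rewrite orbT.
have [a] := trivially_redundant_subst hsigma (hred _ (join_restrict k sJ)).
rewrite /= hs ?mem_head// => ain eh.
have ep : apred a = apred (rhead r) by rewrite -(apred_subst h) -eh.
have hidbp := rhead_idb hr.
(* If the redundant body atom were an IDB atom of [r], its instance under [s] would be an already
   derived fact equal to the head instance, against [new]. *)
have old (c : idb_pos P r) : a <> idb_atom c.
  move=> ec; apply: new; rewrite eh -ep ec hidb.
  by apply: sn_rel_sub ji _ _; apply: idb.
(* The four segments of the resolvent's body: EDB atoms, IDB atoms before [k], the resolved body,
   IDB atoms after [k]. The first is excluded because p is an IDB predicate. *)
move: ain; rewrite !mem_cat => /or4P[||/mapP[b' b'in ea]|].
- by rewrite mem_filter ep hidbp.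
- by move=> /mem_take/idb_atomP[c /old].
- move: b'in ea; rewrite er' => /mapP[b0 b0in ->] ea.
  (* As [h] absorbs [mu], the atom's instance is the one that [t] matched. *)
  have eb : atom_subst s (rhead r) = atom_subst t b0.
    rewrite eh ea -ht ?inE ?b0in ?orbT//.
    by apply: atom_subst_comp => x _; apply: hmuK.
  have epb : apred b0 = apred (rhead r).
    by rewrite -(apred_subst t) -eb.
  (* A database fact cannot have the IDB predicate p; otherwise the head instance was derived by
     step [o], before step [i], against [new]. *)
  have [/hI[_]|b0D] := tbody _ b0in.
    by rewrite apred_subst epb hidbp.
  apply: new; rewrite eb -epb; apply: Delta_range_sub b0D => //; exact: ltnW.
- by move=> /mem_drop/idb_atomP[c /old].
Qed.
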